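(* For any set $S$ there is a bijection $\mathrm{Plas}(\mathcal{P}(S),\mathbb{K})\to \mathrm{Dynk}^{pre}(S_+)$ given by $f\mapsto f^{-1}(0)\cup (f^{-1}(0))^\perp_+$, where $S_+=S\cup\{0\}$ and $X^\perp_+=\{S_+\setminus A: A\in X\}$ for $X\subseteq\mathcal{P}(S)$. If $S$ is finite, this induces a bijection $\mathrm{Plas}(\mathcal{P}(S),\mathbb{K})\cong \mathrm{Dynk}(S_+)$.
   Context: Here $0\notin S$ is an added element, and $\mathcal{P}(T)$ denotes the power set of $T$. A plasma is a set $X$ with a hyperoperation $\star\colon X\times X\to\mathcal{P}(X)$ (empty values allowed) and an element $0\in X$ (the weak identity) such that $x\star y=y\star x$ for all $x,y\in X$ and $x\in x\star 0$ for all $x\in X$. A morphism $(X,\star,0)\to(Y,\boxplus,e)$ is a function $f\colon X\to Y$ with $f(0)=e$ and $f(x\star x')\subseteq f(x)\boxplus f(x')$ for all $x,x'$. $\mathrm{Plas}(X,Y)$ is the set of plasma morphisms. The Krasner hypergroup $\mathbb{K}$ is the plasma $\{0,1\}$ with weak identity $0$ and $0+0=\{0\}$, $0+1=1+0=\{1\}$, $1+1=\{0,1\}$. The power set plasma $\mathcal{P}(S)$ is the power set of $S$ with weak identity $\varnothing$ and $a\star b=\{a\cup b\}$ if $a\cap b=\varnothing$, while $a\star b$ is the empty family if $a\cap b\neq\varnothing$. A family $X\subseteq\mathcal{P}(T)$ is a pre-Dynkin system on $T$ if: (a) $\varnothing\in X$; (b) $A\in X$ implies $T\setminus A\in X$;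 (c) if $A,B\in X$ and $A\cap B=\varnothing$ then $A\cup B\in X$. It is a Dynkin system if moreover (d) whenever $\{A_i\}_{i\in\mathbb{N}}$ is a countable family of pairwise disjoint subsets with all $A_i\in X$, then $\bigcup_i A_i\in X$. $\mathrm{Dynk}^{pre}(T)$ and $\mathrm{Dynk}(T)$ are the sets of pre-Dynkin and Dynkin systems on $T$, respectively. *)

(* Defs.v *)
From mathcomp Require Import all_boot.
From mathcomp Require Import all_classical measurable_structure.

Set Implicit Arguments.
Unset Strict Implicit.
Unset Printing Implicit Defensive.

Local Open Scope classical_set_scope.

Record plasma := Plasma {
  plasma_sort :> Type ;
  hop : plasma_sort -> plasma_sort -> set plasma_sort ;
  weak_id : plasma_sort ;
  hopC : forall x y, hop x y = hop y x ;
  hop_weak_id : forall x, hop x weak_id x }.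
Arguments weak_id {p}.

Definition plasma_morphism (X Y : plasma) (f : X -> Y) : Prop :=
  f weak_id = weak_id /\
  forall x x' : X, f @` hop x x' `<=` hop (f x) (f x').

Definition Plas (X Y : plasma) : set (X -> Y) :=
  [set f | plasma_morphism f].
Arguments Plas : clear implicits.

(* false is the weak identity 0, true is 1 *)
Definition krasner_add (x y : bool) : set bool :=
  match x, y with
  | false, false => [set false]
  | false, true | true, false => [set true]
  | true, true => [set false; true]
  end.

Lemma krasner_addC (x y : bool) : krasner_add x y = krasner_add y x.
Proof. by case: x; case: y. Qed.

Lemma krasner_add0 (x : bool) : krasner_add x false x.
Proof. by case: x. Qed.

Definition krasner : plasma := Plasma krasner_addC krasner_add0.

Definition disjoint_union (S : Type) (a b : set S) : set (set S) :=
  if `[< a `&` b = set0 >] then [set a `|` b] else set0.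

Lemma disjoint_unionC (S : Type) (a b : set S) :
  disjoint_union a b = disjoint_union b a.
Proof. by rewrite /disjoint_union setIC setUC. Qed.

Lemma disjoint_union0 (S : Type) (a : set S) : disjoint_union a set0 a.
Proof.
by rewrite /disjoint_union setI0 setU0; case: asboolP => // /(_ erefl).
Qed.

Definition power_plasma (S : Type) : plasma :=
  Plasma (@disjoint_unionC S) (@disjoint_union0 S).

Definition pre_dynkin (T : Type) (X : set (set T)) : Prop :=
  [/\ X set0,
      setC_closed X &
      forall A B, X A -> X B -> A `&` B = set0 -> X (A `|` B)].

Definition pre_Dynk (T : Type) : set (set (set T)) :=
  [set X | pre_dynkin X].
Arguments pre_Dynk : clear implicits.

Definition Dynk (T : Type) : set (set (set T)) :=
  [set X | pre_dynkin X /\ trivIset_closed X].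
Arguments Dynk : clear implicits.

Lemma DynkE (T : Type) : Dynk T = [set X | dynkin X].
Proof.
apply/seteqP; split => X /= [].
  by move=> [X0 XC _] XU; split => //; rewrite -setC0; exact: XC.
move=> XT XC XU; have X0 : X set0 by rewrite -setCT; exact: XC.
split => //; split => // A B XA XB AB0.
rewrite -bigcup2E; apply: XU; first by rewrite -trivIset_bigcup2.
by case=> [|[|]].
Qed.

(* S_+ is option S, with None the added element; a subset A of S is seen in
   S_+ as Some @` A, so complements below are taken in S_+ *)
Definition plus_family (S : Type) (X : set (set S)) : set (set (option S)) :=
  [set Some @` A | A in X].

Definition perp_plus (S : Type) (X : set (set S)) : set (set (option S)) :=
  [set ~` (Some @` A) | A in X].

Definition morphism_to_dynkin (S : Type) (f : power_plasma S -> krasner) :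
    set (set (option S)) :=
  plus_family (f @^-1` [set weak_id]) `|` perp_plus (f @^-1` [set weak_id]).

(* Main.v *)
Require Import Defs.
From mathcomp Require Import all_boot.
From mathcomp Require Import all_classical measurable_structure.

Set Implicit Arguments.
Unset Strict Implicit.
Unset Printing Implicit Defensive.

Local Open Scope classical_set_scope.

(** Every subset of [option S] is, in exactly one way, either [Some @` A] (when
    it misses [None]) or [~` (Some @` A)] (when it contains [None]). A family
    of subsets of [option S] closed under complement is therefore determined
    by the sets [A] with [Some @` A] in it, and any family of subsets of [S]
    arises in this way: such families are the same thing as functions
    [f : set S -> bool], through [f A = false] iff [Some @` A] is a member.

    Under this dictionary the morphism condition says that for disjoint [a]
    and [b], with [c = a `|` b], the values of [f] at [a], [b], [c] never
    contain exactly one [true]; equivalently, if two of [a], [b], [c] are in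
    [f @^-1` [set false]], then so is the third. Closure of the corresponding
    family under disjoint unions says the same: a union of two sets avoiding
    [None] gives [c] from [a] and [b], whereas the union [~` c `|` a = ~` b],
    with complements in [option S], gives [b] from [a] and [c].
    Two sets containing [None] are never disjoint, so there is nothing else to
    check.

    Over a finite set, countable disjoint unions are finite ones, whence the
    second bijection. *)

(** * Subsets of [option S] *)

Lemma option_set_cases (S : Type) (B : set (option S)) :
  exists A : set S, B = Some @` A \/ B = ~` (Some @` A).
Proof.
have [BN|BN] := pselect (B None).
- exists (Some @^-1` ~` B); right; apply/seteqP; split => [x Bx [s nBs sx]|].
    by apply: nBs; rewrite sx.
  move=> [s|//] ns; apply: contrapT => nBs.
  by apply: ns; exists s.
- exists (Some @^-1` B); left; apply/seteqP; split => [[s|//] Bs|_ [s Bs <-]//].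
  by exists s.
Qed.

Lemma image_Some_neqC (S : Type) (A B : set S) : ~` (Some @` A) <> Some @` B.
Proof.
move=> AB; have : (~` (Some @` A)) None by case.
by rewrite AB => -[].
Qed.

Lemma image_Some_disjoint (S : Type) (a b : set S) :
  (Some @` a) `&` (Some @` b) = set0 <-> a `&` b = set0.
Proof. by rewrite -some_setI some_set_eq0. Qed.

(** Up to the order of the two sets, every disjoint union involving [None] has
    this form: if [~` (Some @` c)] misses [Some @` a], then [a] is a subset
    of [c], and [c = a `|` b] with [b = c `\` a]. *)
Lemma image_Some_setCU (S : Type) (a b : set S) : a `&` b = set0 ->
  ~` (Some @` (a `|` b)) `|` (Some @` a) = ~` (Some @` b).
Proof.
move=> /image_Some_disjoint ab.
rewrite some_setU setCU setUIl setUC setUv setTI.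
by apply/setUidPl => x ax bx; rewrite -[False]/(set0 x) -ab.
Qed.

(** * Membership in the family of a morphism *)

Section MorphismFamily.
Variables (S : Type) (f : power_plasma S -> krasner).

Lemma morphism_to_dynkin_Some (A : set S) :
  morphism_to_dynkin f (Some @` A) <-> f A = false.
Proof.
split=> [[[B fB /image_some_inj <-//]|[B _ /image_Some_neqC//]]|fA].
by left; exists A.
Qed.

Lemma morphism_to_dynkin_setC (X : set (option S)) :
  morphism_to_dynkin f X -> morphism_to_dynkin f (~` X).
Proof.
move=> [[A fA <-]|[A fA <-]]; [right|left; rewrite setCK]; by exists A.
Qed.

(** The hypersum of two ones is the whole of the Krasner hypergroup, so the
    morphism condition is void there; when one summand is zero, the hypersum is
    the singleton of the other summand, and the condition is an equality. *)
Lemma power_plasma_morphismP :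
  plasma_morphism f <->
  f set0 = false /\
  forall a b : set S, a `&` b = set0 -> f a = false ->
    f b = f (a `|` b).
Proof.
split=> [[f0 fD]|[f0 fD]].
- split=> // a b ab fa.
  have /(fD a b) : (f @` disjoint_union a b) (f (a `|` b)).
    by exists (a `|` b) => //; rewrite /disjoint_union asboolT.
  by rewrite fa /=; case: (f b) => /= ->.
- split=> // a b y [c] /=; rewrite /disjoint_union.
  case: asboolP => // ab -> <- {y}.
  case fa: (f a); last by rewrite -(fD a b ab fa); case: (f b).
  case fb: (f b); first by case: (f (a `|` b)); [right|left].
  by rewrite setUC -(fD b a) ?fa// setIC.
Qed.

End MorphismFamily.

(** * The bijection with pre-Dynkin systems *)

Lemma morphism_to_dynkin_pre_dynkin (S : Type)
    (f : power_plasma S -> krasner) :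
  plasma_morphism f -> pre_dynkin (morphism_to_dynkin f).
Proof.
move=> /power_plasma_morphismP[f0 fD].
have fC := @morphism_to_dynkin_setC _ f.
(* [b] is a part of [a], and the union is the complement of the other part,
   where [f] vanishes because it does at [a] and [b] *)
have mixed (a b : set S) : f a = false -> f b = false ->
    ~` (Some @` a) `&` (Some @` b) = set0 ->
    morphism_to_dynkin f (~` (Some @` a) `|` (Some @` b)).
  move=> fa fb ab.
  have sba : b `<=` a.
    apply/sub_image_someP; move: ab; rewrite setIC => /disjoints_subset.
    by rewrite setCK.
  have bab : b `|` (a `\` b) = a by exact: setDUK.
  have dab : b `&` (a `\` b) = set0 by exact: setDIK.
  rewrite -{1}bab image_Some_setCU//; apply/fC/morphism_to_dynkin_Some.
  by rewrite (fD b)// bab.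
split => //; first by rewrite -(@some_set0 S); apply/morphism_to_dynkin_Some.
move=> A B.
have [a [->|->]] := option_set_cases A; have [b [->|->]] := option_set_cases B.
- move=> /morphism_to_dynkin_Some fa /morphism_to_dynkin_Some fb.
  move=> /image_Some_disjoint ab.
  by rewrite -some_setU; apply/morphism_to_dynkin_Some; rewrite -(fD a b).
- move=> /morphism_to_dynkin_Some fa /fC.
  rewrite setCK => /morphism_to_dynkin_Some fb.
  by rewrite setIC setUC; exact: mixed.
- by move=> /fC; rewrite setCK => /morphism_to_dynkin_Some fa
    /morphism_to_dynkin_Some; exact: mixed.
- move=> _ _ ab; exfalso; rewrite -[False]/(set0 (@None S)) -ab.
  by split => -[].
Qed.

(** The inverse bijection: since [X] is closed under complement, it is enough
    to record its members that avoid [None]. *)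
Definition dynkin_to_morphism (S : Type) (X : set (set (option S))) :
    power_plasma S -> krasner :=
  fun A : set S => ~~ `[< X (Some @` A) >].

Lemma dynkin_to_morphism_false (S : Type) (X : set (set (option S)))
    (A : set S) :
  dynkin_to_morphism X A = false <-> X (Some @` A).
Proof. by rewrite /dynkin_to_morphism; case: asboolP. Qed.

Lemma dynkin_to_morphism_morphism (S : Type) (X : set (set (option S))) :
  pre_dynkin X -> plasma_morphism (dynkin_to_morphism X).
Proof.
move=> [X0 XC XU]; apply/power_plasma_morphismP; split.
  by apply/dynkin_to_morphism_false; rewrite some_set0.
move=> a b ab /dynkin_to_morphism_false Xa.
rewrite /dynkin_to_morphism; congr (~~ _).
apply: asbool_equiv_eq; split=> [Xb|Xab].
  by rewrite some_setU; apply: XU => //; apply/image_Some_disjoint.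
(* the complement of [Some @` b] is the disjoint union of [Some @` a] and of
   the complement of [Some @` (a `|` b)] *)
rewrite -[X in _ X]setCK -(image_Some_setCU ab); apply/XC/XU => //.
  exact: XC.
by rewrite some_setU setCU setIAC setICl set0I.
Qed.

Lemma dynkin_to_morphismK (S : Type) (X : set (set (option S))) :
  setC_closed X -> morphism_to_dynkin (dynkin_to_morphism X) = X.
Proof.
move=> XC; apply/seteqP; split=> [B|B].
  by move=> [] [A /dynkin_to_morphism_false XA <-//]; exact: XC.
have [A [->|->]] := option_set_cases B => XA.
  exact/morphism_to_dynkin_Some/dynkin_to_morphism_false.
apply/morphism_to_dynkin_setC/morphism_to_dynkin_Some/dynkin_to_morphism_false.
by rewrite -[X in _ X]setCK; exact: XC.
Qed.

Lemma morphism_to_dynkin_inj (S : Type) : injective (@morphism_to_dynkin S).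
Proof.
move=> f g fg; apply/funext => A.
have [fP Pf] := morphism_to_dynkin_Some f A.
have [gP Pg] := morphism_to_dynkin_Some g A.
move: fP Pf gP Pg; rewrite fg.
case: (f A) (g A) => -[] // fP Pf gP Pg; first exact/fP/Pg.
exact/esym/gP/Pf.
Qed.

Lemma morphism_to_dynkin_bij (S : Type) :
  set_bij (Plas (power_plasma S) krasner) (pre_Dynk (option S))
          (@morphism_to_dynkin S).
Proof.
split=> [f|f g _ _|X preX]; first exact: morphism_to_dynkin_pre_dynkin.
  exact: morphism_to_dynkin_inj.
exists (dynkin_to_morphism X); first exact: dynkin_to_morphism_morphism.
by apply: dynkin_to_morphismK; case: preX.
Qed.

(** * Dynkin systems on a finite set *)

(** Each point of the union of [F] appears at some index; finitely many points
    have bounded indices, so the union is that of an initial segment of [F]. *)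
Lemma finite_bigcup_bounded (T : Type) (F : nat -> set T) :
  finite_set [set: T] ->
  exists N, \bigcup_n F n = \big[setU/set0]_(i < N) F i.
Proof.
move=> finT.
have /choice[n nP] (x : T) : exists n, (\bigcup_n F n) x -> F n x.
  by have [[n _ Fx]|nF] := pselect ((\bigcup_n F n) x); [exists n|exists 0%N].
have /finite_seqP[s ns] := finite_image n finT.
exists (\max_(i <- s) i).+1; rewrite -bigcup_mkord.
apply/seteqP; split=> [x Fx|x [i _ Fix]]; last by exists i.
exists (n x); last exact: nP.
rewrite /= ltnS; apply: (leq_bigmax_seq (F := id)) => //.
by have : (n @` setT) (n x); [exists x|rewrite ns].
Qed.

Lemma pre_dynkin_bigsetU (T : Type) (X : set (set T)) (F : nat -> set T) N :
  pre_dynkin X -> trivIset setT F -> (forall n, X (F n)) ->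
  X (\big[setU/set0]_(i < N) F i).
Proof.
move=> [X0 _ XU] tF XF; elim: N => [|N IH]; first by rewrite big_ord0.
rewrite big_ord_recr; apply: XU => //.
by apply: (@trivIset_bigsetUI _ xpredT) => //; exact: sub_trivIset tF.
Qed.

Lemma finite_pre_DynkE (T : Type) :
  finite_set [set: T] -> pre_Dynk T = Dynk T.
Proof.
move=> finT; apply/seteqP; split=> X /= => [preX|[]//]; split=> // F tF XF.
have [N ->] := finite_bigcup_bounded F finT.
exact: (pre_dynkin_bigsetU _ preX).
Qed.

Lemma finite_set_option (S : Type) :
  finite_set [set: S] -> finite_set [set: option S].
Proof.
move=> finS; rewrite -(setvU [set None]) -some_setT finite_setU.
by split; [exact: finite_image|exact: finite_set1].
Qed.

Theorem corollary4p4 (S : Type) :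
  set_bij (Plas (power_plasma S) krasner) (pre_Dynk (option S))
          (@morphism_to_dynkin S) /\
  (finite_set [set: S] ->
   set_bij (Plas (power_plasma S) krasner) (Dynk (option S))
           (@morphism_to_dynkin S)).
Proof.
have bij := morphism_to_dynkin_bij S; split=> // /finite_set_option finS.
by rewrite -finite_pre_DynkE.
Qed.
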